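(* Let $\alpha\in(0,1)$ be an irrational number which is not of bounded type, let $T:x\mapsto x+\alpha \bmod 1$ on $X=\mathbb{T}^1$, and let $\beta,\gamma\in\mathbb{R}$, $\theta\in\mathbb{R}\setminus\mathbb{Q}$ and a measurable function $\psi:X\to\mathbb{R}$ be such that the function $\varphi(x)=\varphi_{\beta,\gamma}(x)=1_{[0,\beta]}(x)-1_{[0,\beta]}(x+\gamma)$ is not a coboundary over $T$ and $$\theta\,\varphi(x)+\psi(x)=\psi(Tx)\ \bmod 1\quad\text{for a.e. }x\in X.$$ Let $G=\mathbb{R}\times\mathbb{C}^2$ with the composition law $$(t,w_1,w_2)*(t',w_1',w_2')=(t+t',\ w_1+e^{2\pi i t}w_1',\ w_2+e^{2\pi i\theta t}w_2'),$$ let $z_1,z_2$ be given real numbers and, for $x\in X$, let $H_x$ be the closed subgroup of $G$ $$H_x=\{(0,\ vz_1,\ v e^{2\pi i\psi(x)}z_2):\ v\in\mathbb{R}\}.$$ Then there is no subgroup $H\subset G$ for which there exists a measurable function $\zeta:X\to G$ such that $H_x=\zeta(x)^{-1}H\,\zeta(x)$ for a.e. $x\in X$.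
   Context: $\mathbb{T}^1=\mathbb{R}/\mathbb{Z}$ with Lebesgue measure; arguments of functions are taken modulo 1. $\alpha$ is of bounded type if the sequence of partial quotients of its continued fraction expansion is bounded. A measurable function $\varphi$ is a coboundary over $T$ if there is a measurable $\eta:X\to\mathbb{R}$ with $\varphi=\eta\circ T-\eta$ a.e.
   Formalization: The given real numbers z_1, z_2 are assumed to be both nonzero; if z_1 = 0 or z_2 = 0 the claim fails (ζ(x) = (-ψ(x)/θ,0,0), respectively ζ = identity, conjugates a fixed subgroup to H_x). *)

(* Defs.v *)
From HB Require Import structures.
From mathcomp Require Import all_boot all_order all_algebra.
From mathcomp Require Import all_classical all_reals all_analysis.
From mathcomp Require Import complex.
Set Implicit Arguments.
Unset Strict Implicit.
Unset Printing Implicit Defensive.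
Import Order.TTheory GRing.Theory Num.Theory.
Import numFieldNormedType.Exports.
Local Open Scope classical_set_scope.
Local Open Scope complex_scope.
Local Open Scope ring_scope.

Section circle.
Context {R : realType}.
Implicit Types x y alpha beta gamma : R.

Definition fracpart x : R := x - (Num.floor x)%:~R.

(* R/Z is represented by its fundamental domain [0, 1[ with Lebesgue measure;
   functions on R/Z are functions on R of which only the values on [0, 1[
   matter, and arguments are reduced modulo 1 with fracpart. *)
Definition circle : set R := `[0, 1[%classic.

Definition ae_circle (P : R -> Prop) : Prop :=
  {ae @lebesgue_measure R, forall x, circle x -> P x}.

Definition rotation alpha x : R := fracpart (x + alpha).

Definition eqmod1 x y : Prop := x - y \is a Num.int.

(* The indicator of the image of the interval [0, beta] in R/Z (which is empty
   if beta < 0 and everything if beta >= 1), as a 1-periodic function. *)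
Definition arc_indic beta x : R := \1_(`[0, beta]%classic) (fracpart x).

Definition arc_diff beta gamma x : R :=
  arc_indic beta x - arc_indic beta (x + gamma).

Definition coboundary (T phi : R -> R) : Prop :=
  exists eta : R -> R, measurable_fun circle eta /\
    ae_circle (fun x => phi x = eta (T x) - eta x).

(* Complete quotients of the continued fraction expansion; all of them are
   defined by the usual recursion when alpha is irrational. *)
Fixpoint complete_quotient alpha (n : nat) : R :=
  if n is m.+1 then (fracpart (complete_quotient alpha m))^-1 else alpha.

Definition partial_quotient alpha (n : nat) : int :=
  Num.floor (complete_quotient alpha n).

Definition bounded_type alpha : Prop :=
  exists M : int, forall n, partial_quotient alpha n <= M.

End circle.

Section expi.
Context {R : realType}.
Implicit Types s t : R.

(* e^{2 pi i t} *)
Definition expi t : R[i] := cos (2 * pi * t) +i* sin (2 * pi * t).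

Lemma expi0 : expi 0 = 1.
Proof. by rewrite /expi mulr0 cos0 sin0. Qed.

Lemma expiD s t : expi (s + t) = expi s * expi t.
Proof.
rewrite /expi mulrDr cosD sinD.
by apply/eqP; rewrite eq_complex/= eqxx addrC eqxx.
Qed.

Lemma expiNK t : expi (- t) * expi t = 1.
Proof. by rewrite -expiD addNr expi0. Qed.

End expi.

Definition twisted (R : realType) (theta : R) : Type := (R * R[i] * R[i])%type.

Section twisted_group.
Context {R : realType} (theta : R).
Local Notation G := (twisted theta).

HB.instance Definition _ := Choice.on G.

Definition twisted_one : G := (0, 0, 0).

Definition twisted_mul (g h : G) : G :=
  let: (t, w1, w2) := g in let: (t', w1', w2') := h in
  (t + t', w1 + expi t * w1', w2 + expi (theta * t) * w2').

Definition twisted_inv (g : G) : G :=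
  let: (t, w1, w2) := g in
  (- t, - (expi (- t) * w1), - (expi (- (theta * t)) * w2)).

Lemma twisted_mulA : associative twisted_mul.
Proof.
move=> [[t w1] w2] [[t' w1'] w2'] [[s v1] v2] /=.
by rewrite !mulrDr !expiD !mulrA !addrA.
Qed.

Lemma twisted_mul1g : left_id twisted_one twisted_mul.
Proof. by move=> [[t w1] w2] /=; rewrite mulr0 expi0 !mul1r !add0r. Qed.

Lemma twisted_mulg1 : right_id twisted_one twisted_mul.
Proof. by move=> [[t w1] w2] /=; rewrite !mulr0 !addr0. Qed.

Lemma twisted_mulVg : left_inverse twisted_one twisted_inv twisted_mul.
Proof. by move=> [[t w1] w2] /=; rewrite mulrN !addNr. Qed.

Lemma twisted_mulgV : right_inverse twisted_one twisted_inv twisted_mul.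
Proof.
move=> [[t w1] w2] /=; rewrite !mulrN !mulrA -!expiD !subrr expi0 !mul1r.
by rewrite !subrr.
Qed.

HB.instance Definition _ := isGroup.Build G
  twisted_mulA twisted_mul1g twisted_mulg1 twisted_mulVg twisted_mulgV.

(* G is identified with R x R^2 x R^2, so that the product sigma-algebra is
   the Borel sigma-algebra of G. *)
Definition twisted_coord (g : G) : R * (R * R) * (R * R) :=
  let: (t, a +i* b, c +i* d) := g in (t, (a, b), (c, d)).

Definition measurable_twisted (zeta : R -> G) : Prop :=
  measurable_fun circle (twisted_coord \o zeta).

(* The subgroup H_x, for p the value of psi at x. *)
Definition fiber_subgroup (z1 z2 p : R) : set G :=
  [set (0, (v * z1)%:C, v%:C * expi p * z2%:C) | v in [set: R]].

Lemma fiber_subgroup_closed z1 z2 p : group_closed [in fiber_subgroup z1 z2 p].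
Proof.
split; first by apply/mem_set; exists 0 => //; rewrite !mul0r.
move=> _ _ /set_mem[v _ <-] /set_mem[v' _ <-]; apply/mem_set.
exists (v - v') => //; transitivity
  (twisted_mul (0, (v * z1)%:C, v%:C * expi p * z2%:C)
    (twisted_inv (0, (v' * z1)%:C, v'%:C * expi p * z2%:C))) => //=.
by rewrite !mulr0 !oppr0 addr0 expi0 !mul1r mulrBl !rmorphB/= !mulrBl.
Qed.

End twisted_group.

Arguments fiber_subgroup {R} theta z1 z2 p.

(* Main.v *)
Require Import Defs.
From HB Require Import structures.
From mathcomp Require Import all_boot all_order all_algebra.
From mathcomp Require Import all_classical all_reals all_analysis.
From mathcomp Require Import complex measurable_realfun ring lra.
Import Order.TTheory GRing.Theory Num.Theory.
Import numFieldNormedType.Exports.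
Local Open Scope classical_set_scope.
Local Open Scope ring_scope.

(** Conjugating by [g = (t, w1, w2)] multiplies the two complex coordinates of
    an element [(0, a, b)] by the phases [e^(2 pi i t)] and
    [e^(2 pi i theta t)], so a single subgroup [H] that is conjugate by
    [zeta x] to almost every [H_x] forces the real line of C^2 underlying
    [H_x], once turned by the phases of [zeta x], to be independent of [x].
    Fix a good point [x0], let [t] be the first coordinate of [zeta], and let
    [s x = t x0 - t x].  Two real lines spanned by vectors whose coordinates
    have the same nonzero moduli agree only up to sign
    ([conjugate_fibers_phase]): [e^(2 pi i s x)] is [1] or [-1], whence
    [2 s x] is an integer, and, modulo 1,
    [theta s x + psi x0 = s x + psi x].

    Compare this at [x] and at [T x], which is also a good point for almost
    every [x] as the rotation preserves null sets ([ae_circle_rotation]).  With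
    the equation [theta phi + psi = psi o T] it gives
    [theta (s (T x) - s x - phi x) = s (T x) - s x] modulo 1; doubling turns
    the right-hand side into an integer and the factor of [theta] on the left
    into one as well.  As [theta] is irrational that factor vanishes
    ([phase_rigidity]), so [phi x = s (T x) - s x]: the function [phi] is the
    coboundary of [-t], against the hypothesis. *)

(** * Null sets on the circle *)

Section circle_measure.
Context {R : realType}.
Local Notation mu := (@lebesgue_measure R).

(** By uniqueness of Lebesgue measure: its image under a translation gives the
    same lengths to the intervals. *)
Lemma lebesgue_measure_translate (a : R) (A : set R) : measurable A ->
  mu ((fun x => x + a) @^-1` A) = mu A.
Proof.
have mD : measurable_fun [set: R] (fun x : R => x + a).
  exact: (measurable_funD (f:=id) (g:=cst a)).
move=> mA; rewrite -[LHS]/(pushforward mu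
  ((fun x : R => x + a) : _ -> measurableTypeR R) A).
apply/esym/lebesgue_measure_unique => //=.
move=> _ [[b c]] _ <-; rewrite /pushforward.
have -> : (fun x : R => x + a) @^-1` `]b, c]%classic = `]b - a, c - a]%classic.
  by apply/seteqP; split=> x /=; rewrite !in_itv/= ltrBlDr lerBrDr.
rewrite !lebesgue_measure_itv/= !lte_fin ltrD2r.
by case: ifP => // _; rewrite -!EFinB; congr (_%:E); ring.
Qed.

Lemma negligible_translate (a : R) {N : set R} :
  mu.-negligible N -> mu.-negligible ((fun x => x + a) @^-1` N).
Proof.
move=> [A [mA A0 NA]]; exists ((fun x => x + a) @^-1` A); split.
- by rewrite -[X in measurable X]setTI;
    apply: (measurable_funD (f:=id) (g:=cst a)).
- by rewrite lebesgue_measure_translate.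
- by move=> x; apply: NA.
Qed.

Lemma fracpart_circle (x : R) : circle (fracpart x).
Proof.
rewrite /circle /fracpart /= in_itv/= subr_ge0 ltrBlDr.
by rewrite floor_le addrC -(intrD _ _ 1) floorD1_gt.
Qed.

(** On [0, 1[ the rotation by [a] is one of two translations, depending on
    whether [x + a] passes the next integer, so that the preimage of a null set
    is covered by two translates of it. *)
Lemma ae_circle_rotation (a : R) {P : R -> Prop} :
  ae_circle P -> ae_circle (fun x => P (rotation a x)).
Proof.
set N := ~` [set x | circle x -> P x].
move=> nP; have {}nP : mu.-negligible N by exact: nP.
pose k : int := Num.floor a.
suff: mu.-negligible (~` [set x | circle x -> P (rotation a x)]) by [].
apply: negligibleS (negligibleU (negligible_translate (a - k%:~R) nP)
                                (negligible_translate (a - (k + 1)%:~R) nP)).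
move=> x /= /not_implyP[]; rewrite /circle /= in_itv/= => /andP[x0 x1] nPx.
have fr_x : Num.floor (x + a) = k \/ Num.floor (x + a) = k + 1.
  have := floor_le a; have := floorD1_gt a; rewrite -/k intrD => ? ?.
  have [xa|xa] := ltP (x + a) (k + 1)%:~R; [left|right]; apply/eqP;
    rewrite floor_eq xa ?andbT/= ?intrD; rewrite intrD in xa; lra.
have rx := fracpart_circle (x + a).
case: fr_x => fx; [left|right]; apply/not_implyP;
  by rewrite addrA -fx; split.
Qed.

Lemma ae_circle_ex {P : R -> Prop} : ae_circle P -> exists x, P x.
Proof.
move=> nP; apply: contrapT => noP.
have : mu.-negligible (@circle R).
  have {}nP : mu.-negligible (~` [set x | circle x -> P x]) by exact: nP.
  by apply: negligibleS nP => x /= cx Px; apply: noP; exists x; apply: Px.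
move=> nC; have : mu (@circle R) = 0%E.
  by apply: measure_negligible nC; exact: measurable_itv.
by rewrite /circle lebesgue_measure_itv/= lte_fin ltr01 oppr0 adde0 => /eqP;
  rewrite eqe oner_eq0.
Qed.

End circle_measure.

(** * Phases *)

Section phases.
Context {R : realType}.
Implicit Types s t p : R.

Lemma expi_int {t} : t \is a Num.int -> expi t = 1.
Proof.
have expi_nat (n : nat) : expi (n%:R : R) = 1.
  elim: n => [|n IHn]; first exact: expi0.
  rewrite -natr1 expiD IHn mul1r /expi mulr1 mulr_natl.
  by rewrite cos2pi sin2pi.
move=> /intrP[[n|n] ->]; first exact: expi_nat.
by rewrite NegzE intrN -[LHS]mulr1 -[in LHS](expi_nat n.+1) expiNK.
Qed.

(** Subtracting an integer reduces to [t] in [0, 1[, where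
    [cos (2 pi t) = 1 - 2 sin (pi t) ^ 2] is [1] only if [t = 0]. *)
Lemma expi_eq1 {t} : expi t = 1 -> t \is a Num.int.
Proof.
move=> et1; rewrite -[t](subrK (Num.floor t)%:~R) rpredD// ?intr_int//.
suff -> : t - (Num.floor t)%:~R = 0 by rewrite rpred0.
have := fracpart_circle t; rewrite /circle /= in_itv/= => /andP[f0 f1].
have : expi (fracpart t) = 1.
  have := expiD (fracpart t) (Num.floor t)%:~R.
  by rewrite subrK et1 (expi_int (intr_int R _)) mulr1.
case=> c1 _; apply: contrapT => /eqP fN0.
have : 0 < sin (pi * fracpart t).
  apply: sin_gt0_pi; rewrite mulr_gt0 ?pi_gt0//= ?lt0r ?fN0//.
  by rewrite gtr_pMr ?pi_gt0.
move: c1; rewrite (_ : 2 * pi * fracpart t = (pi * fracpart t) *+ 2); last first.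
  by rewrite mulr2n; ring.
rewrite cos_mulr2n cos2sin2 => {et1} ? ?; nra.
Qed.

Lemma expi_eq {s t} : expi s = expi t -> s - t \is a Num.int.
Proof.
by move=> est; apply: expi_eq1; rewrite expiD est -expiD subrr expi0.
Qed.

(** A real number of modulus 1 is its own inverse, so [e^(2 pi i 2s) = 1]. *)
Lemma expi_real {s} {v : R} : expi s = v%:C%C -> s *+ 2 \is a Num.int.
Proof.
move=> esv; apply: expi_eq1; rewrite mulr2n expiD esv.
case: esv => cv sv; have := cos2Dsin2 (2 * pi * s).
by rewrite sv cv expr0n addr0 expr2 -rmorphM/= => ->.
Qed.

(** In the application [s] and [p] are the values at a point [x] of the
    half-integer phase of [zeta] and of [psi], [s'] and [p'] those at [T x],
    and [n] is [phi x]. The congruences combine to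
    [theta (s' - s - n) = s' - s] modulo 1; as [s] and [s'] are only half
    integers, everything is doubled before irrationality is used. *)
Lemma phase_rigidity {theta n s s' p p' p0 : R} : irrational theta ->
    n \is a Num.int -> s *+ 2 \is a Num.int -> s' *+ 2 \is a Num.int ->
    eqmod1 (theta * s + p0) (s + p) -> eqmod1 (theta * s' + p0) (s' + p') ->
    eqmod1 (theta * n + p) p' ->
  n = s' - s.
Proof.
move=> irr nZ sZ s'Z h h' e.
have mZ : s' *+ 2 - s *+ 2 - n *+ 2 \is a Num.int.
  exact: rpredB (rpredB s'Z sZ) (rpredMn 2 nZ).
have qZ : theta * (s' *+ 2 - s *+ 2 - n *+ 2) \is a Num.int.
  have -> : theta * (s' *+ 2 - s *+ 2 - n *+ 2) =
    ((theta * s' + p0 - (s' + p')) - (theta * s + p0 - (s + p))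
      - (theta * n + p - p')) *+ 2 + (s' *+ 2 - s *+ 2) by ring.
  exact: rpredD (rpredMn 2 (rpredB (rpredB h' h) e)) (rpredB s'Z sZ).
have [m0|mN0] := eqVneq (s' *+ 2 - s *+ 2 - n *+ 2) 0; first by lra.
exfalso; apply: irr; move/intrP: qZ => [q qE]; move/intrP: mZ => [m mE].
exists (q%:~R / m%:~R) => //.
by rewrite fmorph_div/= !ratr_int -qE -mE mulfK.
Qed.

Lemma arc_diff_int (beta gamma x : R) : arc_diff beta gamma x \is a Num.int.
Proof. by apply: rpredB; rewrite /arc_indic indicE rpred_nat. Qed.

End phases.

(** * Conjugate lines in the twisted group *)

Section conjugation.
Context {R : realType} (theta : R).
Local Notation G := (twisted theta).

Lemma twisted_conj (g : G) (a b : R[i]) :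
  ((g * ((0, a, b) : G) * g^-1)%g : G) =
  (0, expi g.1.1 * a, expi (theta * g.1.1) * b).
Proof.
case: g => [[t w1] w2] /=.
change (twisted_mul (twisted_mul ((t, w1, w2) : G) ((0, a, b) : G))
   (twisted_inv ((t, w1, w2) : G)) = (0, expi t * a, expi (theta * t) * b)).
rewrite /twisted_mul /twisted_inv.
rewrite addr0 subrr !mulrN !mulrA -!expiD !subrr expi0 !mul1r.
by congr (_, _, _); ring.
Qed.

(** Transport the vector [v = 1] of the first line to [H] and from there to the
    second line, where it is the vector of some parameter [v]. The first
    coordinate, divided by [z1], says that [v] is the phase [e^(2 pi i s)]; the
    second one, divided by [z2], then compares the phases of [z2]. *)
Lemma conjugate_fibers_phase {z1 z2 p0 p : R} {H : set G} {g0 g : G} :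
    z1 != 0 -> z2 != 0 ->
    fiber_subgroup theta z1 z2 p0 = [set (g0^-1 * h * g0)%g | h in H] ->
    fiber_subgroup theta z1 z2 p = [set (g^-1 * h * g)%g | h in H] ->
  let s := g0.1.1 - g.1.1 in
  s *+ 2 \is a Num.int /\ eqmod1 (theta * s + p0) (s + p).
Proof.
move=> z1N0 z2N0 H0 Hg s.
have : fiber_subgroup theta z1 z2 p0 (0, z1%:C%C, expi p0 * z2%:C%C).
  by exists 1 => //; rewrite !mul1r.
rewrite H0 => -[h Hh hE].
have {}hE : h = (0, expi g0.1.1 * z1%:C%C,
    expi (theta * g0.1.1) * (expi p0 * z2%:C%C)).
  by rewrite -twisted_conj -hE !mulgA mulgV mul1g mulgK.
have : fiber_subgroup theta z1 z2 p (g^-1 * h * g)%g by rewrite Hg; exists h.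
have -> : (g^-1 * h * g)%g =
    (0, expi (- g.1.1) * h.1.2, expi (- (theta * g.1.1)) * h.2) :> G.
  rewrite -[X in (_ * X)%g](invgK g) hE twisted_conj.
  by case: (g) => [[t w1] w2] /=; rewrite mulrN.
rewrite hE => -[v _ vE].
have := congr1 (fun k : G => k.1.2) vE; have := congr1 (fun k : G => k.2) vE.
rewrite /= !mulrA -!expiD -mulrN -mulrDr !(addrC (- _)) -/s => v2 v1.
have sv : expi s = v%:C%C.
  have z1N0' : z1%:C%C != 0 by rewrite eq_complex/= eqxx andbT.
  by apply: (mulIf z1N0'); rewrite -rmorphM.
have sP : expi (theta * s + p0) = expi (s + p).
  have z2N0' : z2%:C%C != 0 by rewrite eq_complex/= eqxx andbT.
  by apply: (mulIf z2N0'); rewrite (expiD s) sv v2.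
split; first exact: expi_real sv.
exact: expi_eq sP.
Qed.

End conjugation.

Theorem proposition3p5 (R : realType) (alpha beta gamma theta z1 z2 : R)
    (psi : R -> R)
    (alpha01 : 0 < alpha < 1)
    (alpha_irrational : irrational alpha)
    (alpha_unbounded : ~ bounded_type alpha)
    (theta_irrational : irrational theta)
    (psi_measurable : measurable_fun circle psi)
    (phi_not_coboundary :
      ~ coboundary (rotation alpha) (arc_diff beta gamma))
    (psi_equation : ae_circle (fun x =>
      eqmod1 (theta * arc_diff beta gamma x + psi x) (psi (rotation alpha x))))
    (z1_neq0 : z1 != 0) (z2_neq0 : z2 != 0) :
  ~ exists H : set (twisted theta), group_closed [in H] /\
      exists zeta : R -> twisted theta, measurable_twisted zeta /\
        ae_circle (fun x =>
          fiber_subgroup theta z1 z2 (psi x) =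
          [set ((zeta x)^-1 * h * zeta x)%g | h in H]).
Proof.
move=> [H [_ [zeta [mzeta zetaH]]]]; apply: phi_not_coboundary.
have [x0 Hx0] := ae_circle_ex zetaH.
exists (fun x => - (zeta x).1.1); split.
  apply: measurable_funN.
  rewrite (_ : (fun x => _) =
    fst \o (fst \o (@twisted_coord R theta \o zeta))); last first.
    by apply/funext => x /=; case: (zeta x) => [[t [a b]] [c d]].
  by apply: measurableT_comp => //; apply: measurableT_comp.
have zetaTH := ae_circle_rotation alpha zetaH.
move: psi_equation zetaH zetaTH; rewrite /ae_circle.
have aeF := ae_filter_ringOfSetsType (@lebesgue_measure R).
apply: (@filterS3 _ _ aeF) => x e Hx HTx cx.
have [sZ sE] := conjugate_fibers_phase theta z1_neq0 z2_neq0 Hx0 (Hx cx).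
have [s'Z s'E] := conjugate_fibers_phase theta z1_neq0 z2_neq0 Hx0 (HTx cx).
have -> := phase_rigidity theta_irrational (arc_diff_int _ _ _)
  sZ s'Z sE s'E (e cx).
by ring.
Qed.
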